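(* Let $c$ and $k$ be positive integers with $c>1$, so that $c^{k}-1=\prod_{p\nmid c,\ \operatorname{ord}_p(c)\mid k}p^{f_p+w_p}$ (product over primes $p$). Then $(1,c^{k}-1,c^{k})$ is an $abc$ triple if and only if one of the following conditions holds: (i) there exists a prime $p>\operatorname{rad}(c)$ such that $\operatorname{ord}_p(c)$ divides $k$ and either $f_p\ge 2$ or $w_p\ge 1$; (ii) there exists a prime $p<\operatorname{rad}(c)$ such that $\operatorname{ord}_p(c)$ divides $k$ and $f_p+w_p-1\ge m_p$, where $m_p$ denotes the least positive integer such that $p^{m_p}>\operatorname{rad}(c)$; (iii) for each prime $p$ such that $\operatorname{ord}_p(c)$ divides $k$, there exists a non-negative integer $a_p\le f_p+w_p-1$ such that $\prod_{\operatorname{ord}_p(c)\mid k}p^{a_p}>\operatorname{rad}(c)$.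
   Context: For a positive integer $n$, $\operatorname{rad}(n)$ denotes the product of the distinct prime factors of $n$ (with $\operatorname{rad}(1)=1$). An $abc$ triple is a triple $(a,b,c)$ of relatively prime positive integers with $a+b=c$ and $\operatorname{rad}(abc)<c$. For a prime $p$ not dividing $c$, $\operatorname{ord}_p(c)$ is the least positive integer $t$ with $c^t\equiv 1 \pmod p$. $v_p$ denotes the $p$-adic valuation. For a prime $p$ with $\operatorname{ord}_p(c)\mid k$, set $w_p=v_p(k)$ and $f_p=v_2(c^2-1)-1$ if $p=2$, $c\equiv 3 \pmod 4$ and $k$ is even, and $f_p=v_p\big(c^{\operatorname{ord}_p(c)}-1\big)$ otherwise. *)

(* Defs.v *)
From mathcomp Require Import all_boot.
From mathcomp Require Import boolp.
From mathcomp Require cyclic.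
Set Implicit Arguments.
Unset Strict Implicit.
Unset Printing Implicit Defensive.

Definition rad (n : nat) : nat := \prod_(p <- primes n) p.

(* When a + b = c, joint and pairwise coprimality of a, b, c coincide. *)
Definition abc_triple (a b c : nat) : Prop :=
  [/\ [/\ 0 < a, 0 < b & 0 < c],
      [/\ coprime a b, coprime a c & coprime b c],
      a + b = c & rad (a * b * c) < c].

(* The default value 0 is only taken when P has no witness. *)
Definition least (P : pred nat) : nat :=
  if pselect (exists n, P n) is left exP then ex_minn exP else 0.

Lemma leastP (P : pred nat) :
  (exists n, P n) -> P (least P) /\ (forall m, P m -> least P <= m).
Proof. by move=> exP; rewrite /least; case: pselect => // e; case: ex_minnP. Qed.

Definition ordn (p c : nat) : nat :=
  least (fun t => (0 < t) && (c ^ t == 1 %[mod p])).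

Lemma ordnP (p c : nat) : prime p -> ~~ (p %| c) ->
  [/\ 0 < ordn p c, c ^ ordn p c = 1 %[mod p]
    & forall t, 0 < t -> c ^ t = 1 %[mod p] -> ordn p c <= t].
Proof.
move=> pp npc; have [|/andP[t0 /eqP t1] tmin] :=
  @leastP (fun t => (0 < t) && (c ^ t == 1 %[mod p])).
  exists (totient p); rewrite totient_gt0 prime_gt0 //=; apply/eqP.
  by apply: cyclic.Euler_exp_totient; rewrite coprime_sym prime_coprime.
by split=> // t tgt0 ct; apply: tmin; rewrite tgt0; apply/eqP.
Qed.

Definition relevant (c k p : nat) : bool :=
  [&& prime p, ~~ (p %| c) & ordn p c %| k].

Lemma relevant_dvdn (c k p : nat) :
  0 < c -> relevant c k p -> p %| c ^ k - 1.
Proof.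
move=> c0 /and3P[pp npc /dvdnP[q ->]]; have [_ co _] := ordnP pp npc.
rewrite -eqn_mod_dvd ?expn_gt0 ?c0 //.
by rewrite mulnC expnM -modnXm co modnXm exp1n.
Qed.

Definition f_exp (c k p : nat) : nat :=
  if [&& p == 2, c %% 4 == 3 & ~~ odd k] then logn 2 (c ^ 2 - 1) - 1
  else logn p (c ^ ordn p c - 1).

Definition w_exp (k p : nat) : nat := logn p k.

(* Truncated subtraction f_exp c k p + w_exp k p - 1 is harmless. *)
Lemma f_exp_gt0 (c k p : nat) : 1 < c -> relevant c k p -> 0 < f_exp c k p.
Proof.
move=> c1 /and3P[pp npc _]; rewrite /f_exp.
have c0 : 0 < c by apply: ltnW.
have [o0 co _] := ordnP pp npc.
case: ifP => [/and3P[_ /eqP c3 _]|_].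
  rewrite subn_gt0 -[1 < _]pfactor_dvdn //; last first.
    by rewrite subn_gt0 -[X in X < _](exp1n 2) ltn_exp2r.
  by rewrite -eqn_mod_dvd ?expn_gt0 ?c0 // -modnXm c3.
rewrite logn_gt0 mem_primes pp subn_gt0 -[X in X < _](expn0 c) ltn_exp2l // o0 /=.
by rewrite -eqn_mod_dvd ?expn_gt0 ?c0 //; apply/eqP.
Qed.

(* Every relevant prime is below the bound c ^ k, so a product indexed by
   0 <= p < c ^ k with filter relevant c k ranges over all relevant primes. *)
Lemma relevant_ltn (c k p : nat) :
  1 < c -> 0 < k -> relevant c k p -> p < c ^ k.
Proof.
move=> c1 k0 /(relevant_dvdn (ltnW c1)) pd.
have ck : 1 < c ^ k by rewrite -[X in X < _](expn0 c) ltn_exp2l.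
by rewrite -(subnK (ltnW ck)) addn1 ltnS dvdn_leq // subn_gt0.
Qed.

Definition m_exp (c p : nat) : nat :=
  least (fun m => (0 < m) && (rad c < p ^ m)).

Lemma m_expP (c p : nat) : 1 < p ->
  [/\ 0 < m_exp c p, rad c < p ^ m_exp c p
    & forall m, 0 < m -> rad c < p ^ m -> m_exp c p <= m].
Proof.
move=> p1; have [|/andP[m0 m1] mmin] :=
  @leastP (fun m => (0 < m) && (rad c < p ^ m)).
  by exists (rad c).+1; apply: ltn_trans (ltn_expl _ p1).
by split=> // m mgt0 cm; apply: mmin; rewrite mgt0.
Qed.

(* Main.v *)
Require Import Defs.
From mathcomp Require Import all_boot.
From mathcomp Require cyclic.

(** Lifting the exponent identifies [f_p + w_p] with [v_p (c^k - 1)], whence the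
factorization of [N = c^k - 1].  Since [N] and [c] are coprime,
[rad (N * c^k) = rad N * rad c], so [(1, N, c^k)] is an abc triple iff
[rad c * rad N <= N], i.e. [rad c <= Q] with [Q] the product of the
[p^(f_p + w_p - 1)].  Equality is impossible because [rad c > 1] is coprime to
[Q], and [rad c < Q] is condition (iii), which (i) and (ii) imply through a
single factor of [Q]. *)

Lemma dvdn_big_prod (T : eqType) (s : seq T) (P : pred T) (F : T -> nat) x :
  x \in s -> P x -> F x %| \prod_(i <- s | P i) F i.
Proof. by move=> xs Px; rewrite (big_rem x xs) Px dvdn_mulr. Qed.

(** Modulo [p ^ 2] the binomial expansion of [(1 + p * y) ^ i] stops at [1 + i * (p * y)], and the
    indices [i < n] sum to ['C(n, 2)]. *)
Lemma geometric_sum_mod p y n :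
  \sum_(i < n) (p * y).+1 ^ i = n + 'C(n, 2) * (p * y) %[mod p ^ 2].
Proof.
have expE i : (p * y).+1 ^ i = (i * (p * y)).+1 %[mod p ^ 2].
  elim: i => [|i IHi]; first by rewrite mul0n.
  rewrite expnS -modnMmr IHi modnMmr.
  have -> : (p * y).+1 * (i * (p * y)).+1
            = i * y ^ 2 * p ^ 2 + (i.+1 * (p * y)).+1.
    rewrite -mulnA -expnMn (mulnC y) -mulnn; move: (p * y) => z.
    by rewrite !mulSn mulnS addSn addnS (mulnCA z i) addnA addnC (addnC z).
  by rewrite modnMDl.
elim: n => [|n IHn]; first by rewrite big_ord0.
rewrite big_ord_recr /= -modnDm IHn expE modnDm binS bin1.
by rewrite mulnDl addSn !addnS addnA.
Qed.

(** The cofactor of [x - 1] in [x ^ n - 1] is a geometric sum congruent to [n] mod [p], hence prime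
    to [p]. *)
Lemma logn_predn_exp_coprime p x n : prime p -> 1 < x -> 0 < n ->
  p %| x.-1 -> coprime p n -> logn p (x ^ n).-1 = logn p x.-1.
Proof.
move=> pp x1 n0 px cpn; have x0 := ltnW x1.
have sum0 : 0 < \sum_(i < n) x ^ i by case: n n0 {cpn} => // n _; rewrite big_ord_recl.
have xm0 : 0 < x.-1 by rewrite -subn1 subn_gt0.
rewrite predn_exp lognM // [X in _ + X]lognE pp sum0 /=.
case: ifP => [|_]; last by rewrite addn0.
have x1p : x = 1 %[mod p] by apply/eqP; rewrite eqn_mod_dvd ?subn1.
have -> : (p %| \sum_(i < n) x ^ i) = (p %| n).
  rewrite /dvdn -modn_summ (eq_bigr (fun=> 1 %% p)) => [|i _].
    by rewrite modn_summ sum1_card card_ord.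
  by rewrite -modnXm x1p modnXm exp1n.
by move=> pn; move: cpn; rewrite prime_coprime // pn.
Qed.

(** Here the geometric sum is congruent to [p] mod [p ^ 2], so its valuation is exactly one. *)
Lemma logn_predn_exp_prime p x : prime p -> 1 < x ->
  p ^ (p == 2).+1 %| x.-1 -> logn p (x ^ p).-1 = (logn p x.-1).+1.
Proof.
move=> pp x1 px; have x0 := ltnW x1; have p1 := prime_gt1 pp.
have sum0 : 0 < \sum_(i < p) x ^ i.
  by case: p {pp px} p1 => // p _; rewrite big_ord_recl.
have xm0 : 0 < x.-1 by rewrite -subn1 subn_gt0.
rewrite predn_exp lognM // -[RHS]addn1; congr (_ + _).
have /dvdnP[y xE] : p %| x.-1.
  by apply: dvdn_trans px; rewrite dvdn_exp.
have sumE : \sum_(i < p) x ^ i = p %[mod p ^ 2].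
  have {1}-> : x = (p * y).+1 by rewrite mulnC -xE prednK.
  rewrite geometric_sum_mod -modnDmr.
  suff /eqP-> : p ^ 2 %| 'C(p, 2) * (p * y) by rewrite addn0.
  (* For [p = 2] the hypothesis gives [4 %| p * y]; for odd [p] the second factor [p] comes from
     ['C(p, 2)]. *)
  have [p2|pN2] := eqVneq p 2.
    by move: px; rewrite xE p2 eqxx /= mulnC => px; rewrite dvdn_mull.
  rewrite mulnA -mulnn dvdn_mulr // dvdn_mul //.
  by rewrite prime_dvd_bin //= ltn_neqAle eq_sym pN2.
apply/eqP; rewrite eqn_leq leqNgt -!pfactor_dvdn // expn1.
rewrite /dvdn sumE modn_small; last by rewrite -[X in X < _]expn1 ltn_exp2l.
rewrite -lt0n prime_gt0 //=.
by rewrite /dvdn -(@modn_dvdm (p ^ 2)) ?dvdn_exp // sumE modn_dvdm ?dvdn_exp // modnn.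
Qed.

(* At [p = 2] lifting the exponent needs [4 %| x - 1], as [x = 3] shows. *)
Lemma logn_predn_exp p x n : prime p -> 1 < x -> 0 < n ->
  p ^ (p == 2).+1 %| x.-1 -> logn p (x ^ n).-1 = logn p x.-1 + logn p n.
Proof.
move=> pp x1 n0 px; have p0 := prime_gt0 pp.
have [m cpm ->] := pfactor_coprime pp n0.
have m0 : 0 < m by case: m cpm n0 => //; rewrite /coprime gcdn0 => /eqP p1;
    rewrite p1 in pp.
rewrite lognM ?expn_gt0 ?p0 // pfactorK // (logn_coprime cpm) add0n.
rewrite mulnC expnM.
(* Each factor [p] of the exponent is absorbed by replacing [x] with [x ^ p], so [x] must vary in
   the induction; the part [m] prime to [p] is left for the base case. *)
elim: (logn p n) x x1 px => [|e IHe] x x1 px.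
  rewrite expn1 addn0 logn_predn_exp_coprime //.
  by apply: dvdn_trans px; rewrite dvdn_exp.
rewrite expnS expnM IHe ?logn_predn_exp_prime ?addSnnS //.
  by rewrite -[X in X < _](exp1n p) ltn_exp2r.
by rewrite predn_exp dvdn_mulr.
Qed.

Lemma ordn_dvdn p c n : prime p -> ~~ (p %| c) ->
  (ordn p c %| n) = (c ^ n == 1 %[mod p]).
Proof.
move=> pp npc; have [o0 co omin] := ordnP pp npc.
have cE : c ^ n = c ^ (n %% ordn p c) %[mod p].
  by rewrite {1}(divn_eq n (ordn p c)) expnD (mulnC _ (ordn p c)) expnM -modnMml -modnXm co
             modnXm exp1n modnMml mul1n.
apply/idP/eqP => [/eqP n0|c1]; first by rewrite cE n0.
rewrite /dvdn -leqn0 leqNgt; apply/negP => r0.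
have := omin _ r0; rewrite -cE => /(_ c1).
by rewrite leqNgt ltn_mod o0.
Qed.

Lemma relevantE c k p : 1 < c -> 0 < k ->
  relevant c k p = (p \in primes (c ^ k - 1)).
Proof.
move=> c1 k0; have c0 := ltnW c1.
rewrite /relevant mem_primes subn_gt0 -[X in X < _](expn0 c) ltn_exp2l // k0 /=.
have [pp|//] := boolP (prime p); rewrite /= -eqn_mod_dvd ?expn_gt0 ?c0 //.
have [pc|npc] := boolP (p %| c); last by rewrite ordn_dvdn.
(* If [p %| c], then [c ^ k] is 0 mod [p] because [k > 0], so it is not 1. *)
apply/esym/negbTE; rewrite -modnXm (eqP pc) exp0n // mod0n.
by rewrite modn_small ?prime_gt1.
Qed.

(** By Fermat the order divides [p - 1]. Hence dividing [k] by the order does not change its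
    [p]-adic valuation. *)
Lemma coprime_ordn p c : prime p -> ~~ (p %| c) -> coprime p (ordn p c).
Proof.
move=> pp npc; have p1 := prime_gt1 pp.
have : ordn p c %| p.-1.
  rewrite ordn_dvdn // -totient_prime //; apply/eqP.
  by apply: cyclic.Euler_exp_totient; rewrite coprime_sym prime_coprime.
move/coprime_dvdr; apply.
have p10 : 0 < p.-1 by rewrite -subn1 subn_gt0.
by rewrite prime_coprime // gtnNdvd // ltn_predL prime_gt0.
Qed.

(** The exponent is lifted from the base [c ^ ordn p c], except when [p = 2], [c] is 3 mod 4 and [k]
    is even: then 4 does not divide [c - 1], and the base is [c ^ 2]. *)
Lemma logn_expn_sub1 c k p : 1 < c -> 0 < k -> relevant c k p ->
  logn p (c ^ k - 1) = f_exp c k p + w_exp k p.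
Proof.
move=> c1 k0 /and3P[pp npc ok]; have c0 := ltnW c1.
have [o0 co _] := ordnP pp npc; have p1 := prime_gt1 pp.
have x1 : 1 < c ^ ordn p c by rewrite -[X in X < _](expn0 c) ltn_exp2l.
have px : p %| (c ^ ordn p c).-1.
  by rewrite -subn1 -eqn_mod_dvd ?expn_gt0 ?c0 // co.
have q0 : 0 < k %/ ordn p c by rewrite divn_gt0 // dvdn_leq.
have kE : k = ordn p c * (k %/ ordn p c) by rewrite mulnC divnK.
have wE : w_exp k p = logn p (k %/ ordn p c).
  by rewrite /w_exp {1}kE lognM // logn_coprime ?coprime_ordn.
rewrite /f_exp; case: ifP => [/and3P[/eqP p2 /eqP c3 ke]|special].
  move: pp; rewrite {}p2 /w_exp => pp.
  have c21 : 1 < c ^ 2 by rewrite -[X in X < _](exp1n 2) ltn_exp2r.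
  have k20 : 0 < k./2 by rewrite half_gt0; case: k k0 ke {ok q0 kE wE} => [|[]].
  have d4 : 4 %| (c ^ 2).-1.
    by rewrite -subn1 -eqn_mod_dvd ?expn_gt0 ?c0 // -modnXm c3.
  have kE2 : k = 2 * k./2 by rewrite mul2n even_halfK.
  (* The [- 1] in [f_exp] offsets the difference between the valuations of [k] and [k./2]. *)
  rewrite [in LHS]kE2 expnM !subn1 logn_predn_exp // [in RHS]kE2 lognM //.
  rewrite [logn 2 2]/= addnA addn1 prednK //.
  by rewrite logn_gt0 mem_primes -[X in _ < X]subn1 subn_gt0 c21 (dvdn_trans _ d4).
rewrite wE {1}kE expnM !subn1.
have [p2|pN2] := eqVneq p 2; last first.
  by rewrite logn_predn_exp // (negbTE pN2).
have o1 : ordn p c = 1.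
  apply/eqP; rewrite -dvdn1 ordn_dvdn // expn1 p2 !modn2.
  by move: npc; rewrite p2 dvdn2 negbK => ->.
rewrite o1 expn1 divn1 in px x1 *.
(* With [p = 2], an odd [k] falls under the coprime case; for even [k], the excluded special case
   leaves [c] equal to 1 mod 4, so [4 %| c - 1]. *)
have [ko|ke] := boolP (odd k).
  have cpk : coprime p k by rewrite p2 coprime2n.
  by rewrite logn_predn_exp_coprime // (logn_coprime cpk) addn0.
apply: logn_predn_exp => //; rewrite p2 eqxx -subn1 -eqn_mod_dvd //.
have : odd c by move: npc; rewrite p2 dvdn2 negbK.
move: special; rewrite p2 eqxx ke andbT /=.
rewrite -[in odd c](odd_mod c (erefl : odd 4 = false)).
by have := ltn_pmod c (isT : 0 < 4); case: (c %% 4) => [|[|[|[]]]].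
Qed.

(** For [n = c ^ k - 1] the bound [n.+1] is [c ^ k], the range of the products in the theorem. *)
Lemma prod_expn_logn n :
  0 < n -> n = \prod_(0 <= p < n.+1 | p \in primes n) p ^ logn p n.
Proof.
move=> n0; rewrite -[LHS](partnT n0) /partn big_mkcond [RHS]big_mkcond.
apply: eq_bigr => p _ /=; case: ifP => // /negbT.
by rewrite -logn_gt0 -leqNgt leqn0 => /eqP->.
Qed.

Lemma radE n : rad n = \prod_(0 <= p < n.+1 | p \in primes n) p.
Proof.
rewrite /rad -[RHS]big_filter; apply: perm_big; apply: uniq_perm.
- exact: primes_uniq.
- by rewrite filter_uniq // iota_uniq.
move=> p; rewrite mem_filter mem_index_iota /=.
case: (boolP (p \in primes n)) => //=.
by rewrite mem_primes => /and3P[_ n0 pn]; rewrite ltnS dvdn_leq.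
Qed.

Lemma radM m n : 0 < m -> 0 < n -> coprime m n -> rad (m * n) = rad m * rad n.
Proof.
move=> m0 n0 cmn; rewrite /rad -big_cat; apply: perm_big; apply: uniq_perm.
- exact: primes_uniq.
- by rewrite cat_uniq !primes_uniq andbT /= -coprime_has_primes.
by move=> p; rewrite primesM // mem_cat.
Qed.

Lemma radX n k : 0 < k -> rad (n ^ k) = rad n.
Proof. by move=> k0; rewrite /rad primesX. Qed.


Theorem theorem2p9 (c k : nat) (hc : 1 < c) (hk : 0 < k) :
  c ^ k - 1 = \prod_(0 <= p < c ^ k | relevant c k p) p ^ (f_exp c k p + w_exp k p) /\
  (abc_triple 1 (c ^ k - 1) (c ^ k) <->
   [\/ exists p : nat, [/\ relevant c k p, rad c < p
         & 2 <= f_exp c k p \/ 1 <= w_exp k p],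
       exists p : nat, [/\ relevant c k p, p < rad c
         & m_exp c p <= f_exp c k p + w_exp k p - 1]
     | exists a : nat -> nat,
         (forall p : nat, relevant c k p -> a p <= f_exp c k p + w_exp k p - 1) /\
         rad c < \prod_(0 <= p < c ^ k | relevant c k p) p ^ a p]).
Proof.
have c0 := ltnW hc.
set N := c ^ k - 1; pose e p := f_exp c k p + w_exp k p - 1.
have N0 : 0 < N by rewrite subn_gt0 -[X in X < _](expn0 c) ltn_exp2l.
have ckE : c ^ k = N.+1 by rewrite /N subn1 prednK // expn_gt0 c0.
have relE p : relevant c k p = (p \in primes N) by rewrite relevantE.
have relp p : relevant c k p -> prime p by case/and3P.
have factN :
    N = \prod_(0 <= p < c ^ k | relevant c k p) p ^ (f_exp c k p + w_exp k p).
  rewrite {1}[N]prod_expn_logn // ckE; apply: eq_big => // p.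
  by rewrite -relE => rp; rewrite logn_expn_sub1.
split=> //.
set Q := \prod_(0 <= p < c ^ k | relevant c k p) p ^ e p.
have radN : rad N = \prod_(0 <= p < c ^ k | relevant c k p) p.
  by rewrite radE ckE; apply: eq_bigl => p; rewrite relE.
(* As [f_exp] is positive on relevant primes, each exponent is [e p + 1], and the spare factor [p]
   goes to the radical. *)
have NE : N = Q * rad N.
  rewrite radN -big_split [LHS]factN; apply: eq_bigr => p rp /=.
  by rewrite -expnSr /e subn1 prednK // addn_gt0 f_exp_gt0.
have radN0 : 0 < rad N by move: N0; rewrite {1}NE muln_gt0 => /andP[].
have cop : coprime N (c ^ k) by rewrite ckE coprimenS.
have radcQ : rad c != Q.
  (* Under equality, a prime factor of [c] would divide [Q], hence both [N] and [c ^ k]. *)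
  apply/eqP => rQ; have pp := pdiv_prime hc.
  have prc : pdiv c %| rad c.
    by apply: dvdn_big_prod; rewrite // mem_primes pp c0 pdiv_dvd.
  have pN : pdiv c %| N by rewrite NE dvdn_mulr // -rQ.
  have pck : pdiv c %| c ^ k by rewrite (dvdn_trans (pdiv_dvd c)) // dvdn_exp.
  have : pdiv c %| gcdn N (c ^ k) by rewrite dvdn_gcd pN.
  by rewrite (eqP cop) dvdn1 => /eqP p1; rewrite p1 in pp.
have abcE : abc_triple 1 N (c ^ k) <-> rad c < Q.
  have -> : (rad c < Q) = (rad (1 * N * c ^ k) < c ^ k).
    (* Since [c ^ k = N + 1], the strict bound becomes [rad c * rad N <= Q * rad N], and [rad N]
       cancels. *)
    rewrite mul1n radM ?expn_gt0 ?c0 // radX // ltn_neqAle radcQ /=.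
    by rewrite ckE ltnS [X in _ = (_ <= X)]NE mulnC leq_pmul2r.
  split=> [[]//|lt]; split=> //.
  - by rewrite N0 expn_gt0 c0.
  - by rewrite !coprime1n.
have Q0 : 0 < Q by move: N0; rewrite {1}NE muln_gt0 => /andP[].
have factor_le p : relevant c k p -> p ^ e p <= Q.
  move=> rp; apply: dvdn_leq => //; apply: (@dvdn_big_prod _ _ _ (fun p => p ^ e p)) => //.
  by rewrite mem_index_iota relevant_ltn.
(* The largest admissible exponents, [a = e], make the product in (iii) equal to [Q]. *)
rewrite abcE; split=> [lt|]; first by apply: Or33; exists e.
case=> [[p [rp ltp fw]]|[p [rp _ me]]|[a [ae lt]]].
- apply: leq_trans (factor_le p rp); apply: leq_trans ltp _.
  (* Either alternative in (i) gives [e p >= 1], the second one because [f_exp] is positive. *)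
  rewrite -[X in X <= _]expn1 leq_exp2l ?prime_gt1 ?relp // /e.
  rewrite subn_gt0; case: fw => [f2|w1]; first exact: ltn_addr.
  by rewrite -[2]/(1 + 1) leq_add // f_exp_gt0.
- have p1 := prime_gt1 (relp p rp); have [_ cm _] := m_expP c p1.
  by apply: leq_trans (factor_le p rp); apply: leq_trans cm _; rewrite leq_exp2l.
- apply: leq_trans lt _; apply: leq_prod => p rp.
  by rewrite leq_exp2l ?ae // prime_gt1 ?relp.
Qed.
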